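(* Let $K$ be any real cubic number field. For $(i,j),(k,l)\in Ind$, let $\theta(i,j)$ denote the unique element of $\{0,1,2\}\setminus\{i,j\}$. If $(k,l)\neq(i,\theta(i,j))$ and $(k,l)\neq(\theta(i,j),i)$, then there exists $(\alpha,\beta)\in\Delta_K$ such that $\varepsilon_K(\alpha,\beta)=(i,j)$ and $\varepsilon_K(T_K(\alpha,\beta))=(k,l)$.
   Context: Let $K\subset\mathbb{R}$ be a real cubic number field, $N=N_{K/\mathbb{Q}}$ its norm. Fix $r=p/q$ with $p,q$ positive coprime integers and $3\nmid p$. Let $\Delta_K=\{(\alpha,\beta)\in K^2:\ 1,\alpha,\beta \text{ linearly independent over }\mathbb{Q},\ \alpha,\beta>0,\ \alpha+\beta<1\}$ and $Ind=\{(i,j): i,j\in\{0,1,2\},\ i\neq j\}$. Let $\Delta=\{(x,y)\in\mathbb{R}^2: x,y\ge 0,\ x+y\le 1\}$ and $\triangle(1,2)=\{(x,y)\in\Delta: x\ge y\}$, $\triangle(2,1)=\{x\le y\}$, $\triangle(0,1)=\{2x+y-1\le 0\}$, $\triangle(1,0)=\{2x+y-1\ge 0\}$, $\triangle(0,2)=\{x+2y-1\le0\}$, $\triangle(2,0)=\{x+2y-1\ge 0\}$ (all subsets of $\Delta$). Maps $T_{(i,j)}:\triangle(i,j)\to\Delta$: $T_{(1,2)}(x,y)=(\frac{x-y}{1-y},\frac{y}{1-y})$, $T_{(2,1)}(x,y)=(\frac{x}{1-x},\frac{y-x}{1-x})$, $T_{(0,1)}(x,y)=(\frac{x}{1-x},\frac{y}{1-x})$,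 $T_{(1,0)}(x,y)=(\frac{2x+y-1}{x+y},\frac{y}{x+y})$, $T_{(0,2)}(x,y)=(\frac{x}{1-y},\frac{y}{1-y})$, $T_{(2,0)}(x,y)=(\frac{x}{x+y},\frac{x+2y-1}{x+y})$. For $(\alpha,\beta)\in\Delta_K$ put $\gamma=1-\alpha-\beta$ and $v_{\{1,2\}}=\frac{\alpha^r\beta^r}{|N(\alpha)N(\beta)|}$, $v_{\{0,1\}}=\frac{\alpha^r\gamma^r}{|N(\alpha)N(\gamma)|}$, $v_{\{0,2\}}=\frac{\beta^r\gamma^r}{|N(\beta)N(\gamma)|}$; the maximum is attained at a unique pair $\{i_0,j_0\}$. $\varepsilon_K(\alpha,\beta)$ is the ordered pair $(i,j)\in Ind$ with $\{i,j\}=\{i_0,j_0\}$ and $(\alpha,\beta)\in\triangle(i,j)$, and $T_K(\alpha,\beta)=T_{\varepsilon_K(\alpha,\beta)}(\alpha,\beta)$ (a map $\Delta_K\to\Delta_K$). *)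

(* Defs.v *)
From HB Require Import structures.
From mathcomp Require Import all_boot all_order all_algebra.
From mathcomp Require Import all_classical all_reals all_analysis.
From mathcomp Require Import Rstruct.
Set Implicit Arguments. Unset Strict Implicit. Unset Printing Implicit Defensive.
Import Order.TTheory GRing.Theory Num.Theory.
Local Open Scope ring_scope.

Notation RR := Rdefinitions.R.

(* A real cubic number field K ⊂ R is presented by a Q-basis e_0,e_1,e_2 of K:
   the reals e_i are Q-linearly independent, their Q-span contains 1 and is
   closed under multiplication (a finite-dimensional Q-subalgebra of R that is
   a domain, hence a field of degree 3). *)
Definition qcomb (e : 'I_3 -> RR) (c : 'I_3 -> rat) : RR :=
  \sum_(i < 3) ratr (c i) * e i.

Definition is_cubic_basis (e : 'I_3 -> RR) : Prop :=
  [/\ (forall c : 'I_3 -> rat, qcomb e c = 0 -> forall i, c i = 0),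
      (exists c : 'I_3 -> rat, qcomb e c = 1) &
      (forall i j : 'I_3, exists c : 'I_3 -> rat, e i * e j = qcomb e c)].

Definition inK (e : 'I_3 -> RR) (x : RR) : Prop := exists c, x = qcomb e c.

Definition mulmat_of (e : 'I_3 -> RR) (x : RR) : set 'M[rat]_3 :=
  [set M | forall i : 'I_3, x * e i = \sum_(j < 3) ratr (M i j) * e j].

(* The norm N_{K/Q}(x) = det of the Q-linear map "multiplication by x" on K
   (the matrix is unique for x in K). *)
Definition normK (e : 'I_3 -> RR) (x : RR) : RR :=
  ratr (\det (xget 0 (mulmat_of e x))).

Definition inDeltaK (e : 'I_3 -> RR) (a b : RR) : Prop :=
  inK e a /\ inK e b /\
  (forall x y z : rat, ratr x + ratr y * a + ratr z * b = 0 ->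
      [/\ x = 0, y = 0 & z = 0]) /\
  0 < a /\ 0 < b /\ a + b < 1.

Definition coordv (a b : RR) (i : nat) : RR :=
  match i with 0%N => 1 - a - b | 1%N => a | _ => b end.

Definition vK (e : 'I_3 -> RR) (r : RR) (a b : RR) (i j : nat) : RR :=
  (coordv a b i) `^ r * (coordv a b j) `^ r /
  `|normK e (coordv a b i) * normK e (coordv a b j)|.

Definition theta (i j : nat) : nat := (3 - i - j)%N.

Definition inDelta (x y : RR) : Prop := [/\ 0 <= x, 0 <= y & x + y <= 1].

Definition tri (i j : nat) (x y : RR) : Prop :=
  inDelta x y /\
  match i, j with
  | 1%N, 2%N => y <= x
  | 2%N, 1%N => x <= y
  | 0%N, 1%N => 2 * x + y - 1 <= 0
  | 1%N, 0%N => 0 <= 2 * x + y - 1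
  | 0%N, 2%N => x + 2 * y - 1 <= 0
  | 2%N, 0%N => 0 <= x + 2 * y - 1
  | _, _ => False
  end.

Definition Tmap (i j : nat) (x y : RR) : RR * RR :=
  match i, j with
  | 1%N, 2%N => ((x - y) / (1 - y), y / (1 - y))
  | 2%N, 1%N => (x / (1 - x), (y - x) / (1 - x))
  | 0%N, 1%N => (x / (1 - x), y / (1 - x))
  | 1%N, 0%N => ((2 * x + y - 1) / (x + y), y / (x + y))
  | 0%N, 2%N => (x / (1 - y), y / (1 - y))
  | 2%N, 0%N => (x / (x + y), (x + 2 * y - 1) / (x + y))
  | _, _ => (x, y)
  end.

(* epsK e r a b i j  <->  (a,b) ∈ Delta_K and eps_K(a,b) = (i,j):
   the pair {i,j} is the (unique) maximiser of v, and (a,b) ∈ triangle(i,j). *)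
Definition epsK (e : 'I_3 -> RR) (r : RR) (a b : RR) (i j : nat) : Prop :=
  inDeltaK e a b /\ (i < 3)%N /\ (j < 3)%N /\ i != j /\
  vK e r a b i (theta i j) < vK e r a b i j /\
  vK e r a b j (theta i j) < vK e r a b i j /\
  tri i j a b.

(* T_K(a,b) = T_{eps_K(a,b)}(a,b) *)

(* Main.v *)
Require Import Defs.
From HB Require Import structures.
From mathcomp Require Import all_boot all_order all_algebra.
From mathcomp Require Import all_classical all_reals all_analysis.
From mathcomp Require Import Rstruct.
From mathcomp Require Import ring lra zify.
From mathcomp.real_closed Require Import polyorder.
Import Order.TTheory GRing.Theory Num.Theory.
Import numFieldNormedType.Exports.
Local Open Scope ring_scope.

(* In the projective coordinates X = (gamma, alpha, beta) put
   n(x) = |N(x)| / x^r.  Then eps_K = (i, j) iff n is largest at X_theta(i,j) and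
   X_i >= X_j, and T_(i,j) replaces X_i by X_i - X_j.  So one has to find x_i, x_j,
   y in K with prescribed order relations such that n(y) exceeds n(x_i), n(x_j),
   and n(x_i - x_j) lies on a prescribed side of n(y).
   For w in K \ Q with characteristic polynomial f, the element m t (s - w)
   (m large, t and s rational, s close to w) has norm (m t)^3 f(s), so if its real
   value is close to v, then n is about m^2 |f'(w)| t^2 v^(1-r).  Here f'(w) <> 0
   since a common root of f and f' would give f a rational root.  Taking t = 1 for
   x_i and t = -1 for x_j gives t = 2 for x_i - x_j, hence a factor 4 in n, while y
   is built from another w' independent of 1, w, with t tuned as needed. *)

(** * Continuity of the rescaled norm near a real target value *)

Lemma powR_continuous_at (R : realType) (a v : R) :
  0 < v -> {for v, continuous (fun x : R => x `^ a)}.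
Proof.
move=> v0; apply/differentiable_continuous/derivable1_diffP/derivable_powR.
by rewrite in_itv /= v0.
Qed.

(** Meant for x = m t (s - w) and d = 1 / (m t), so that w + x d = s. Joint continuity at (v, 0)
    then handles x -> v and m -> oo at once. *)
Lemma scaled_norm_near (R : realType) (g : {poly R}) (w v t a A B : R) :
  0 < v -> A < t ^+ 2 * v `^ a * `|g.[w]| < B ->
  exists2 rho, 0 < rho & forall x d, `|x - v| < rho -> `|d| < rho ->
    A < t ^+ 2 * x `^ a * `|g.[w + x * d]| < B.
Proof.
move=> v0 /andP[HA HB].
pose G := fun p : R * R => t ^+ 2 * p.1 `^ a * `|g.[w + p.1 * p.2]|.
have Gc : (G p @[p --> (v, 0 : R)] --> t ^+ 2 * v `^ a * `|g.[w]|)%classic.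
  have c1 : (p.1 @[p --> (v, 0 : R)] --> v)%classic by exact: cvg_fst.
  have c2 : (p.2 @[p --> (v, 0 : R)] --> (0 : R))%classic by exact: cvg_snd.
  apply: cvgM.
    apply: cvgMr.
    by apply: (@continuous_cvg _ _ _ _ _ fst (fun x => x `^ a)) => //; exact: powR_continuous_at.
  apply: cvg_norm.
  apply: (@continuous_cvg _ _ _ _ _ (fun p : R * R => w + p.1 * p.2) (horner g)).
    exact: continuous_horner.
  rewrite -[X in (_ --> X)%classic]addr0; apply: cvgD; first exact: cvg_cst.
  by rewrite -[X in (_ --> X)%classic](mulr0 v); apply: cvgM.
have GA : \forall p \near (v, 0 : R), A < G p by exact: (cvgr_gt _ Gc).
have GB : \forall p \near (v, 0 : R), G p < B by exact: (cvgr_lt _ Gc).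
have /nbhs_ballP[rho /= rho0 H] : \forall p \near (v, 0 : R), A < G p < B.
  by near=> p; apply/andP; split; near: p.
exists rho => // x d xv d0; apply: (H (x, d)); split => /=; rewrite /ball/=.
  by rewrite distrC.
by rewrite sub0r normrN.
Unshelve. all: by end_near. Qed.

(** * Multiplication matrices, the field structure of K and its norm *)

Definition basis_col (e : 'I_3 -> RR) : 'cV[RR]_3 := \col_i e i.

Notation ratr_mx := (map_mx (@ratr RR)).

(** This relational form passes to sums, products and inverses, so the choice of matrix hidden in
    [normK] is dealt with only once, in [normK_repr]. *)
Definition mul_repr (e : 'I_3 -> RR) (x : RR) (M : 'M[rat]_3) : Prop :=
  x *: basis_col e = ratr_mx M *m basis_col e.

Lemma mul_reprP e x M : mul_repr e x M <-> mulmat_of e x M.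
Proof.
split=> [/matrixP H i|H].
  by have := H i 0; rewrite !mxE => ->; apply: eq_bigr => j _; rewrite !mxE.
by apply/matrixP=> i j; rewrite !mxE H; apply: eq_bigr => l _; rewrite !mxE.
Qed.

Lemma row_basis_colE e (c : 'I_3 -> rat) :
  (ratr_mx (\row_j c j) *m basis_col e) = (qcomb e c)%:M.
Proof.
apply/matrixP=> i j; rewrite !ord1 !mxE eqxx mulr1n.
by apply: eq_bigr => l _; rewrite !mxE.
Qed.

Lemma ratr_mx_basis_inj e n (M : 'M[rat]_(n, 3)) :
  is_cubic_basis e -> ratr_mx M *m basis_col e = 0 -> M = 0.
Proof.
case=> indep _ _ /matrixP H; apply/matrixP=> i j; rewrite mxE.
apply: (indep (M i)); have := H i 0; rewrite !mxE => <-.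
by apply: eq_bigr => l _; rewrite !mxE.
Qed.

Lemma mul_repr_uniq e x M M' :
  is_cubic_basis e -> mul_repr e x M -> mul_repr e x M' -> M = M'.
Proof.
move=> He H H'; apply/eqP; rewrite -subr_eq0; apply/eqP.
by apply: (ratr_mx_basis_inj _ _ _ He); rewrite map_mxB mulmxBl -H -H' subrr.
Qed.

Lemma normK_repr e x M :
  is_cubic_basis e -> mul_repr e x M -> normK e x = ratr (\det M).
Proof.
move=> He HM; rewrite /normK; congr (ratr (\det _)).
apply: (mul_repr_uniq e x) => //; apply/mul_reprP.
by apply: xgetPex; exists M; apply/mul_reprP.
Qed.

Lemma mul_repr_rat e s : mul_repr e (ratr s) s%:M.
Proof. by rewrite /mul_repr map_scalar_mx mul_scalar_mx. Qed.

Lemma mul_reprD e x y M N :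
  mul_repr e x M -> mul_repr e y N -> mul_repr e (x + y) (M + N).
Proof. by rewrite /mul_repr => Hx Hy; rewrite scalerDl Hx Hy map_mxD mulmxDl. Qed.

Lemma mul_reprN e x M : mul_repr e x M -> mul_repr e (- x) (- M).
Proof. by rewrite /mul_repr => Hx; rewrite scaleNr Hx map_mxN mulNmx. Qed.

Lemma mul_reprM e x y M N :
  mul_repr e x M -> mul_repr e y N -> mul_repr e (x * y) (M *m N).
Proof.
by rewrite /mul_repr => Hx Hy; rewrite map_mxM -mulmxA -Hy -scalemxAr -Hx scalerA mulrC.
Qed.

(** If c is the coordinate row of 1, then x = x * 1 has coordinate row c M. *)
Lemma mul_repr_inK e x M : is_cubic_basis e -> mul_repr e x M -> inK e x.
Proof.
case=> _ [c c1] _ HM; exists (fun j => ((\row_j c j) *m M) 0 j).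
have := row_basis_colE e (fun j => ((\row_j c j) *m M) 0 j).
rewrite (_ : \row_j _ = (\row_j c j) *m M); last first.
  by apply/matrixP=> i j; rewrite mxE ord1.
rewrite map_mxM -mulmxA -HM -scalemxAr row_basis_colE c1.
by move=> /matrixP/(_ 0 0); rewrite !mxE eqxx mulr1 !mulr1n.
Qed.

Lemma inK_mul_repr e x : is_cubic_basis e -> inK e x -> exists M, mul_repr e x M.
Proof.
case=> _ _ clos [c ->].
have [d Hd] := choice (fun p : 'I_3 * 'I_3 => clos p.1 p.2).
exists (\matrix_(i, j) \sum_l c l * d (l, i) j).
apply/mul_reprP => i; rewrite /qcomb mulr_suml.
under eq_bigr => l _ do rewrite -mulrA (Hd (l, i)) /qcomb mulr_sumr.
rewrite exchange_big; apply: eq_bigr => j _ /=.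
rewrite mxE rmorph_sum mulr_suml; apply: eq_bigr => l _.
by rewrite rmorphM mulrA.
Qed.

Lemma inK_rat e s : is_cubic_basis e -> inK e (ratr s).
Proof. by move=> He; exact: (mul_repr_inK _ _ _ He (mul_repr_rat e s)). Qed.

Lemma inKD e x y : is_cubic_basis e -> inK e x -> inK e y -> inK e (x + y).
Proof.
move=> He /(inK_mul_repr _ _ He)[M HM] /(inK_mul_repr _ _ He)[N HN].
exact: (mul_repr_inK _ _ _ He (mul_reprD _ _ _ _ _ HM HN)).
Qed.

Lemma inKM e x y : is_cubic_basis e -> inK e x -> inK e y -> inK e (x * y).
Proof.
move=> He /(inK_mul_repr _ _ He)[M HM] /(inK_mul_repr _ _ He)[N HN].
exact: (mul_repr_inK _ _ _ He (mul_reprM _ _ _ _ _ HM HN)).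
Qed.

Lemma inKN e x : is_cubic_basis e -> inK e x -> inK e (- x).
Proof.
move=> He /(inK_mul_repr _ _ He)[M HM].
exact: (mul_repr_inK _ _ _ He (mul_reprN _ _ _ HM)).
Qed.

Lemma normKM e x y : is_cubic_basis e -> inK e x -> inK e y ->
  normK e (x * y) = normK e x * normK e y.
Proof.
move=> He /(inK_mul_repr _ _ He)[M HM] /(inK_mul_repr _ _ He)[N HN].
rewrite (normK_repr _ _ _ He HM) (normK_repr _ _ _ He HN).
by rewrite (normK_repr _ _ _ He (mul_reprM _ _ _ _ _ HM HN)) det_mulmx rmorphM.
Qed.

(** A rational row v with v M = 0 gives x (v . e) = 0, so v . e = 0, and independence of the basis
    forces v = 0. *)
Lemma mul_repr_det_neq0 e x M :
  is_cubic_basis e -> mul_repr e x M -> x != 0 -> \det M != 0.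
Proof.
move=> He HM x0; apply/det0P => -[v v0 vM]; case/negP: v0; apply/eqP.
apply: (ratr_mx_basis_inj e) => //.
have : x *: (ratr_mx v *m basis_col e) = 0.
  by rewrite scalemxAr HM mulmxA -map_mxM vM map_mx0 mul0mx.
by move/eqP; rewrite scaler_eq0 (negPf x0) => /eqP.
Qed.

Lemma normK_neq0 e x : is_cubic_basis e -> inK e x -> x != 0 -> normK e x != 0.
Proof.
move=> He /(inK_mul_repr _ _ He)[M HM] x0.
by rewrite (normK_repr _ _ _ He HM) fmorph_eq0; exact: (mul_repr_det_neq0 e x).
Qed.

Lemma inKV e x : is_cubic_basis e -> inK e x -> inK e x^-1.
Proof.
move=> He Hx; have [->|x0] := eqVneq x 0; first by rewrite invr0 -(rmorph0 (@ratr RR)); exact: inK_rat.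
have [M HM] := inK_mul_repr _ _ He Hx.
have Mu : M \in unitmx by rewrite unitmxE unitfE; exact: (mul_repr_det_neq0 e x).
apply: (mul_repr_inK e _ (invmx M)) => //; rewrite /mul_repr.
have -> : x^-1 *: basis_col e
    = x^-1 *: (ratr_mx (invmx M) *m (ratr_mx M *m basis_col e)).
  by rewrite mulmxA -map_mxM mulVmx // map_mx1 mul1mx.
by rewrite -HM -scalemxAr scalerA mulVf // scale1r.
Qed.

(** * Characteristic polynomials and norms of linear expressions in w *)

Lemma horner_char_poly (F : comNzRingType) n (M : 'M[F]_n) s :
  (char_poly M).[s] = \det (s%:M - M).
Proof.
rewrite /char_poly -[LHS]/(horner_eval s _) -det_map_mx; congr (\det _).
apply/matrixP=> i j; rewrite !mxE -[LHS]/(('X *+ (i == j) - (M i j)%:P).[s]).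
by rewrite hornerD hornerMn hornerX hornerN hornerC.
Qed.

(** Suppose f'(w) = 0. The remainder of f modulo f' has degree at most 1 and vanishes at the
    irrational w, so it is 0. The quotient is then linear over the rationals, and its root is a
    rational root of f. *)
Lemma deriv_neq0_of_cubic (f : {poly rat}) (w : RR) :
  size f = 4 -> (forall s, ~~ root f s) -> (forall s : rat, w <> ratr s) ->
  (map_poly ratr f).[w] = 0 -> (map_poly ratr f)^`().[w] != 0.
Proof.
move=> sf noroot irr fw; apply/eqP => dw.
pose h := f^`().
have sh : size h = 3 by rewrite size_deriv sf.
have h0 : h != 0 by rewrite -size_poly_eq0 sh.
have hw : (map_poly ratr h).[w] = 0 by rewrite -deriv_map.
have fE := divp_eq f h.
have rw : (map_poly ratr (f %% h)).[w] = 0.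
  by move: fw; rewrite {1}fE rmorphD rmorphM /= hornerD hornerM hw mulr0 add0r.
have sr : (size (f %% h)%R <= 2)%N by have := ltn_modp f h; rewrite h0 sh ltnS.
have r0 : f %% h = 0.
  have rE : f %% h = ((f %% h)`_0)%:P + (f %% h)`_1 *: 'X.
    apply/polyP => -[|[|i]]; rewrite !coefE /= ?mulr0 ?mulr1 ?addr0 ?add0r //.
    by rewrite nth_default // (leq_trans sr).
  move: rw; rewrite rE rmorphD /= map_polyC map_polyZ map_polyX !hornerE => rw.
  have [b0|b0] := eqVneq ((f %% h)`_1) 0.
    move: rw; rewrite b0 rmorph0 mul0r addr0 => /eqP; rewrite fmorph_eq0 => /eqP ->.
    by rewrite scale0r addr0.
  case: (irr (- (f %% h)`_0 / (f %% h)`_1)); rewrite fmorph_div rmorphN.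
  have b0' : ratr ((f %% h)`_1) != 0 :> RR by rewrite fmorph_eq0.
  apply: (mulfI b0'); rewrite mulrCA divff // mulr1.
  by apply/eqP; rewrite -addr_eq0 addrC rw.
have [s rs] := @poly2_root _ (f %/ h) ltac:(by rewrite size_divp // sf sh).
by case/negP: (noroot s); rewrite fE r0 addr0 rootM rs.
Qed.


(** The characteristic polynomial F of multiplication by w factors as g (X - w), so g(w) = F'(w),
    while the norm of s - w is F(s). *)
Lemma normK_linear e w : is_cubic_basis e -> inK e w ->
  (forall s : rat, w <> ratr s) ->
  exists2 g : {poly RR}, g.[w] != 0 &
  forall s t : rat,
    normK e (ratr t * (ratr s - w)) = ratr t ^+ 3 * ((ratr s - w) * g.[ratr s]).
Proof.
move=> He Kw irr; have [M HM] := inK_mul_repr _ _ He Kw.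
have HMs s : mul_repr e (ratr s - w) (s%:M - M).
  by apply: mul_reprD; [exact: mul_repr_rat | exact: mul_reprN].
have Ks s : inK e (ratr s - w) by exact: mul_repr_inK (HMs s).
pose f := char_poly M; pose F := map_poly (@ratr RR) f.
(* The matrix w - M kills the nonzero column of basis elements, so it cannot be invertible. *)
have Fw : root F w.
  rewrite /root /F map_char_poly horner_char_poly.
  apply/negPn/negP; rewrite -unitfE -unitmxE => U.
  have E0 : basis_col e = 0.
    rewrite -[LHS]mul1mx -(mulVmx U) -mulmxA mulmxBl mul_scalar_mx HM subrr mulmx0 //.
  have I0 : (1%:M : 'M[rat]_3) = 0.
    by apply: (ratr_mx_basis_inj e) => //; rewrite E0 mulmx0.
  by move/matrixP/(_ 0 0): I0; rewrite !mxE eqxx.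
have [g Fg] := factor_theorem _ _ Fw.
have fs s : \det (s%:M - M) = f.[s] by rewrite horner_char_poly.
have nr s : ~~ root f s.
  rewrite /root -fs; apply: (mul_repr_det_neq0 _ _ _ He (HMs s)).
  by rewrite subr_eq0 eq_sym; apply/eqP; exact: irr.
exists g.
  have := deriv_neq0_of_cubic f w (size_char_poly M) nr irr (rootP Fw).
  by rewrite -/F Fg derivM hornerD !hornerM hornerXsubC subrr mulr0 add0r derivXsubC hornerC mulr1.
move=> s t; rewrite normKM //; last exact: inK_rat.
rewrite (normK_repr _ _ _ He (mul_repr_rat e t)) det_scalar rmorphXn /=; congr (_ * _).
rewrite (normK_repr _ _ _ He (HMs s)) fs -horner_map /= -/F Fg hornerM hornerXsubC.
by rewrite mulrC.
Qed.

(** * Rational independence and a basis of K containing 1 *)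

Definition rat_free (x y z : RR) : Prop :=
  forall a b c : rat, ratr a * x + ratr b * y + ratr c * z = 0 ->
    [/\ a = 0, b = 0 & c = 0].

Lemma rat_free_swap12 x y z : rat_free x y z -> rat_free y x z.
Proof. by move=> H a b c E; case: (H b a c) => //; rewrite -E; ring. Qed.

Lemma rat_free_swap23 x y z : rat_free x y z -> rat_free x z y.
Proof. by move=> H a b c E; case: (H a c b) => //; rewrite -E; ring. Qed.

Lemma rat_free_sub x y z : rat_free x y z -> rat_free (x - y) y z.
Proof.
move=> H a b c E; case: (H a (b - a) c) => [|-> /eqP + ->].
  by rewrite rmorphB /= -E; ring.
by rewrite subr0 => /eqP ->.
Qed.

(** Exchange argument: 1 has a nonzero coordinate at some e_m, so 1 can replace e_m in the basis. *)
Lemma exists_basis_with_one e : is_cubic_basis e ->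
  exists w w', [/\ inK e w, inK e w' & rat_free 1 w w'].
Proof.
move=> He; have [indep [d d1] _] := He.
have Ke m : inK e (e m).
  exists (fun i => (i == m)%:R); rewrite /qcomb (bigD1 m) //= eqxx rmorph1 mul1r.
  by rewrite big1 ?addr0 // => i /negPf->; rewrite rmorph0 mul0r.
have [m dm] : exists m, d m != 0.
  apply: contrapT => nd; have d0 i : d i = 0.
    by apply/eqP; apply: contra_notT nd => di; exists i.
  move: d1; rewrite /qcomb big1 => [/eqP|i _]; first by rewrite eq_sym oner_eq0.
  by rewrite d0 rmorph0 mul0r.
have sum3 (F : 'I_3 -> RR) : \sum_i F i = F m + F (lift m 0) + F (lift m 1).
  rewrite (bigD1_ord m) //= !big_ord_recl big_ord0 addr0 addrA.
  congr (_ + F (lift m _) + F (lift m _)); exact: val_inj.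
exists (e (lift m 0)), (e (lift m 1)); split=> // a b c E.
(* These are the coordinates of a + b w + c w' in the basis e. *)
pose k i : rat := a * d i + (if unlift m i is Some j then (if j == 0 then b else c) else 0).
have k0 i : k i = 0.
  apply: indep; rewrite -E -d1 /qcomb mulr_sumr !sum3 /k unlift_none !liftK /=.
  by rewrite !rmorphD !rmorphM /= rmorph0; ring.
have a0 : a = 0.
  have := k0 m; rewrite /k unlift_none addr0.
  by move/eqP; rewrite mulf_eq0 (negPf dm) orbF => /eqP.
split=> //.
  by have := k0 (lift m 0); rewrite /k liftK a0 mul0r add0r.
by have := k0 (lift m 1); rewrite /k liftK a0 mul0r add0r.
Qed.

(** * The weighted norm n(x) = |N(x)| / x^r *)

Definition wnorm (e : 'I_3 -> RR) (r x : RR) : RR := `|normK e x| / x `^ r.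

Lemma wnorm_gt0 e r x : is_cubic_basis e -> inK e x -> 0 < x -> 0 < wnorm e r x.
Proof.
move=> He Kx x0; rewrite divr_gt0 ?powR_gt0 // normr_gt0.
by apply: normK_neq0 => //; rewrite gt_eqF.
Qed.

Lemma wnormM e r x y : is_cubic_basis e -> inK e x -> inK e y -> 0 < x -> 0 < y ->
  wnorm e r (x * y) = wnorm e r x * wnorm e r y.
Proof.
move=> He Kx Ky x0 y0; rewrite /wnorm normKM // normrM powRM ?ltW //.
by move: (normK e x) (normK e y) => A B; rewrite mulf_div.
Qed.

(** For positive coordinates in K, v is therefore largest on the pair that omits the index of
    largest n. *)
Lemma vK_wnorm e r a b i j :
  vK e r a b i j = (wnorm e r (coordv a b i) * wnorm e r (coordv a b j))^-1.
Proof.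
rewrite /vK /wnorm; move: (normK _ _) (normK _ _) => A B.
by rewrite mulf_div invf_div normrM.
Qed.

(* Writing x = m t (s - w), the norm of x is m^2 t^2 x g(s) with g as in
   [normK_linear], and s -> w as m -> oo while x stays near v. *)
Lemma wnorm_linear_near e r w : is_cubic_basis e -> inK e w ->
  (forall s : rat, w <> ratr s) ->
  exists2 C, 0 < C & forall (v : RR) (t : rat) A B, 0 < v -> t != 0 ->
    A < ratr t ^+ 2 * v `^ (1 - r) * C < B ->
    exists2 rho, 0 < rho & forall (m : nat) s, rho^-1 < m%:R ->
      `|ratr (m%:R * t) * (ratr s - w) - v| < rho ->
      A * m%:R ^+ 2 < wnorm e r (ratr (m%:R * t) * (ratr s - w)) < B * m%:R ^+ 2.
Proof.
move=> He Kw irr; have [g g0 gN] := normK_linear _ _ He Kw irr.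
exists `|g.[w]|; first by rewrite normr_gt0.
move=> v t A B v0 t0 HAB.
have t0' : ratr t != 0 :> RR by rewrite fmorph_eq0.
have [rho0 rho00 H] := scaled_norm_near _ g w v (ratr t) (1 - r) A B v0 HAB.
(* The bound v keeps x positive, [rho0] controls x - v, and the last term turns the lower bound on m
   into |1 / (m t)| < [rho0]. *)
exists (Num.min v (Num.min rho0 (rho0 * `|ratr t|))).
  by rewrite !lt_min v0 rho00 mulr_gt0 // normr_gt0.
move=> m s; set rho := Num.min _ _ => Hm.
set x := ratr _ * _ => Hx.
have rho_gt0 : 0 < rho by rewrite /rho !lt_min v0 rho00 mulr_gt0 // normr_gt0.
have m0 : 0 < m%:R :> RR by apply: lt_trans Hm; rewrite invr_gt0.
have mt0 : m%:R * ratr t != 0 :> RR by rewrite mulf_neq0 // gt_eqF.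
have [xv xr0] : `|x - v| < v /\ `|x - v| < rho0.
  by move: Hx; rewrite !lt_min => /andP[-> /andP[-> _]].
have x0 : 0 < x by move: xv; rewrite ltr_distl subrr => /andP[].
have d0 : `|(m%:R * ratr t)^-1| < rho0.
  rewrite normfV normrM gtr0_norm // invfM -ltr_pdivlMr ?invr_gt0 ?normr_gt0 //.
  rewrite invrK invf_plt ?posrE // ?mulr_gt0 ?normr_gt0 //.
  apply: le_lt_trans Hm; rewrite lef_pV2 ?posrE ?mulr_gt0 ?normr_gt0 //.
  by rewrite !ge_min lexx !orbT.
have xE : x = m%:R * ratr t * (ratr s - w) by rewrite /x rmorphM /= ratr_nat.
have xd : x / (m%:R * ratr t) = ratr s - w by rewrite xE [X in X / _]mulrC mulfK.
have := H x _ xr0 d0; rewrite xd [w + _]addrC subrK.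
(* Of the three factors m t in the norm, one combines with s - w into x; dividing by x^r leaves
   x^(1-r). *)
have -> : wnorm e r x = ratr t ^+ 2 * x `^ (1 - r) * `|g.[ratr s]| * m%:R ^+ 2.
  rewrite /wnorm [in normK _ _]/x gN -/x.
  rewrite powRB; last by rewrite (gt_eqF x0) implybT.
  rewrite powRr1 ?ltW //.
  rewrite rmorphM /= ratr_nat.
  have -> : (m%:R * ratr t) ^+ 3 * ((ratr s - w) * g.[ratr s])
    = (m%:R * ratr t) ^+ 2 * x * g.[ratr s] by rewrite xE; ring.
  have mx0 : 0 <= (m%:R * ratr t) ^+ 2 * x by rewrite mulr_ge0 ?sqr_ge0 // ltW.
  by rewrite normrM (ger0_norm mx0); ring.
by rewrite !ltr_pM2r ?exprn_gt0.
Qed.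

(** * Construction of a triple with prescribed norm comparisons *)

Lemma ratr_affine_dense (w v rho : RR) (t : rat) : 0 < rho -> t != 0 ->
  exists s : rat, `|ratr t * (ratr s - w) - v| < rho.
Proof.
move=> rho0 t0; have t0' : ratr t != 0 :> RR by rewrite fmorph_eq0.
have d0 : 0 < rho / `|ratr t| by rewrite divr_gt0 // normr_gt0.
have [s] := @rat_in_itvoo RR (w + v / ratr t - rho / `|ratr t|)
  (w + v / ratr t + rho / `|ratr t|) ltac:(lra).
rewrite in_itv /= -ltr_distl => H; exists s.
have -> : ratr t * (ratr s - w) - v = ratr t * (ratr s - (w + v / ratr t)) by field.
by rewrite normrM mulrC -ltr_pdivlMr // normr_gt0.
Qed.

(** Tunes the factor t of y so that n(y) falls into a prescribed window. *)
Lemma rat_square_between (k lo hi : RR) : 0 < k -> 0 < lo -> lo < hi ->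
  exists2 t : rat, t != 0 & lo < k * ratr t ^+ 2 < hi.
Proof.
move=> k0 lo0 lohi; have hi0 := lt_trans lo0 lohi.
have [t] := @rat_in_itvoo RR (Num.sqrt (lo / k)) (Num.sqrt (hi / k))
  ltac:(by rewrite ltr_sqrt ?divr_gt0 // ltr_pM2r ?invr_gt0).
rewrite in_itv /= => /andP[H1 H2].
have t0 : 0 < ratr t :> RR by apply: le_lt_trans H1; rewrite sqrtr_ge0.
exists t; first by apply/eqP => t1; move: t0; rewrite t1 rmorph0 ltxx.
rewrite mulrC; apply/andP; split.
  rewrite -ltr_pdivrMr // -[lo / k]sqr_sqrtr ?divr_ge0 ?ltW //.
  by rewrite ltr_pXn2r ?nnegrE ?sqrtr_ge0 ?(ltW t0).
rewrite -ltr_pdivlMr // -[hi / k]sqr_sqrtr ?divr_ge0 ?ltW //.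
by rewrite ltr_pXn2r ?nnegrE ?sqrtr_ge0 ?(ltW t0).
Qed.

(** The flag [big] tells whether y still has the largest n after the subtraction. If so, y is simply
    given a large enough factor t. If not, n(y) must fit between the values at xi, xj and the value
    at xi - xj, and the last hypothesis makes room for it. *)
Lemma exists_wnorm_triple e (r vi vj vy rho0 : RR) (big : bool) :
  is_cubic_basis e -> 0 < vj -> vj < vi -> 0 < vy -> 0 < rho0 ->
  (~~ big -> vi `^ (1 - r) < 4 * (vi - vj) `^ (1 - r) /\
             vj `^ (1 - r) < 4 * (vi - vj) `^ (1 - r)) ->
  exists xi xj y : RR,
    [/\ inK e xi, inK e xj, inK e y & rat_free xi xj y] /\
    [/\ `|xi - vi| < rho0, `|xj - vj| < rho0 & `|y - vy| < rho0] /\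
    [/\ 0 < xi, 0 < xj, 0 < y & xj < xi] /\
    [/\ wnorm e r xi < wnorm e r y, wnorm e r xj < wnorm e r y &
        if big then wnorm e r (xi - xj) < wnorm e r y
        else wnorm e r y < wnorm e r (xi - xj)].
Proof.
move=> He vj0 vij vy0 rho00 Hbig.
have vi0 := lt_trans vj0 vij.
have vz0 : 0 < vi - vj by rewrite subr_gt0.
have [w [w' [Kw Kw' free]]] := exists_basis_with_one _ He.
have irr (s : rat) : w <> ratr s.
  move=> ws; have [] := free (- s) 1 0; last by [].
  by rewrite rmorphN rmorph1 rmorph0 ws; ring.
have irr' (s : rat) : w' <> ratr s.
  move=> ws; have [] := free (- s) 0 1; last by [].
  by rewrite rmorphN rmorph1 rmorph0 ws; ring.
have [C C0 HC] := wnorm_linear_near _ r _ He Kw irr.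
have [C' C'0 HC'] := wnorm_linear_near _ r _ He Kw' irr'.
(* Limits of n / m^2 at xi, xj and xi - xj; the 4 is the square of t = 2. *)
pose ai := vi `^ (1 - r) * C; pose aj := vj `^ (1 - r) * C.
pose az := 4 * (vi - vj) `^ (1 - r) * C.
have ai0 : 0 < ai by rewrite mulr_gt0 ?powR_gt0.
have aj0 : 0 < aj by rewrite mulr_gt0 ?powR_gt0.
have az0 : 0 < az by rewrite !mulr_gt0 ?powR_gt0.
(* Window for n(y) / m^2. Without [big], its ends trisect the gap between max(ai, aj) and az. *)
have [lo [hi [lo0 lohi ailo ajlo azlh]]] : exists lo hi,
    [/\ 0 < lo, lo < hi, ai < lo, aj < lo & if big then az < lo else hi < az].
  case: big Hbig => [_|/(_ isT)[]].
    by exists (ai + aj + az), (ai + aj + az + 1); split; lra.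
  move=> iz jz; have {}iz : ai < az by rewrite ltr_pM2r.
  have {}jz : aj < az by rewrite ltr_pM2r.
  have [ij|ji] := leP ai aj.
    by exists ((2 * aj + az) / 3), ((aj + 2 * az) / 3); split; lra.
  by exists ((2 * ai + az) / 3), ((ai + 2 * az) / 3); split; lra.
have k0 : 0 < vy `^ (1 - r) * C' by rewrite mulr_gt0 ?powR_gt0.
have [tau tau0 Htau] := rat_square_between _ _ _ k0 lo0 lohi.
have [rhoi rhoi0 Hi] := HC vi 1 (ai - 1) lo vi0 (oner_neq0 _)
  ltac:(by rewrite rmorph1 expr1n mul1r -/ai ailo andbT; lra).
have [rhoj rhoj0 Hj] := HC vj (-1) (aj - 1) lo vj0 ltac:(by [])
  ltac:(by rewrite rmorphN1 sqrrN expr1n mul1r -/aj ajlo andbT; lra).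
have e4 : ratr 2 ^+ 2 = 4 :> RR by rewrite ratr_nat; ring.
have [rhoz rhoz0 Hz] := HC (vi - vj) 2 (if big then az - 1 else hi)
  (if big then lo else az + 1) vz0 ltac:(by [])
  ltac:(by rewrite e4 -/az; case: big azlh {Hbig} => h; apply/andP; split; lra).
have [rhoy rhoy0 Hy] := HC' vy tau lo hi vy0 tau0 ltac:(by rewrite -mulrA mulrC).
(* Half of the minimum is taken because the errors of xi and xj add up in xi - xj. The terms vj, vy
   and vi - vj secure positivity. *)
pose rmin := Num.min (Num.min (Num.min rhoi rhoj) (Num.min rhoz rhoy))
  (Num.min rho0 (Num.min (Num.min vj vy) (vi - vj))).
pose rho := rmin / 2.
have rho_gt0 : 0 < rho.
  by rewrite divr_gt0 // /rmin !lt_min rhoi0 rhoj0 rhoz0 rhoy0 rho00 vj0 vy0 vz0.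
have : 2 * rho <= rmin by rewrite /rho; lra.
rewrite /rmin !le_min.
case/andP => /andP[/andP[ri rj] /andP[rz ry]] /and3P[r0 /andP[rvj rvy] rvz].
have [m Hm] : exists m : nat, rho^-1 < m%:R.
  exists (Num.bound rho^-1); apply: le_lt_trans (archi_boundP _); last by rewrite invr_ge0 ltW.
  by [].
have m0 : 0 < m%:R :> RR by apply: lt_trans Hm; rewrite invr_gt0.
have mq0 : m%:R != 0 :> rat.
  by apply/eqP => mz; move: m0; rewrite -(ratr_nat RR m) mz rmorph0 ltxx.
have le2 rho' : 2 * rho <= rho' -> rho <= rho'.
  by apply: le_trans; rewrite ler_peMl ?ler1n // ltW.
have Hm' rho' : 2 * rho <= rho' -> rho'^-1 < m%:R.
  move=> /le2 h; apply: le_lt_trans Hm.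
  by rewrite lef_pV2 ?posrE //; exact: lt_le_trans h.
have [si Xi] := ratr_affine_dense w vi _ (m%:R * 1) rho_gt0 ltac:(by rewrite mulr1).
have [sj Xj] := ratr_affine_dense w vj _ (m%:R * -1) rho_gt0 ltac:(by rewrite mulrN1 oppr_eq0).
have [sy Xy] := ratr_affine_dense w' vy _ (m%:R * tau) rho_gt0 ltac:(by rewrite mulf_neq0).
have {}Hi := Hi m si (Hm' _ ri) (lt_le_trans Xi (le2 _ ri)).
have {}Hj := Hj m sj (Hm' _ rj) (lt_le_trans Xj (le2 _ rj)).
have {}Hy := Hy m sy (Hm' _ ry) (lt_le_trans Xy (le2 _ ry)).
set xi := ratr (m%:R * 1) * _ in Xi Hi.
set xj := ratr (m%:R * -1) * _ in Xj Hj.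
set y := ratr (m%:R * tau) * _ in Xy Hy.
(* As xj has t = -1, the two multiples of w add up: the difference has t = 2 and the midpoint of si
   and sj as its s. *)
have zE : xi - xj = ratr (m%:R * 2) * (ratr ((si + sj) / 2) - w).
  rewrite /xi /xj !rmorphM /= rmorphD /= rmorphN1 rmorph1 fmorphV !ratr_nat.
  by field.
have Xz : `|xi - xj - (vi - vj)| < 2 * rho.
  move: Xi Xj; rewrite !ltr_norml => /andP[? ?] /andP[? ?]; apply/andP; split; lra.
have {Hz} := Hz m ((si + sj) / 2) (Hm' _ rz).
rewrite -zE => /(_ (lt_le_trans Xz rz)) Hz.
have Kx t s u : inK e u -> inK e (ratr t * (ratr s - u)).
  by move=> Ku; apply: inKM => //; [|apply: inKD => //; [|exact: inKN]]; exact: inK_rat.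
have xi0 : 0 < xi by move: Xi; rewrite ltr_norml => /andP[? ?]; lra.
have xj0 : 0 < xj by move: Xj; rewrite ltr_norml => /andP[? ?]; lra.
have y0 : 0 < y by move: Xy; rewrite ltr_norml => /andP[? ?]; lra.
exists xi, xj, y; split; [split; [exact: Kx | exact: Kx | exact: Kx |] | split; [|split]].
- move=> a b c E.
  (* Coefficients of 1, w and w' in a xi + b xj + c y. *)
  have [|e1 e2 e3] := free (m%:R * (a * si - b * sj + c * tau * sy)) (m%:R * (b - a))
    (- (m%:R * tau * c)).
    rewrite -E /xi /xj /y !(rmorphM, rmorphN, rmorphD, rmorph1, rmorphB) /=; ring.
  have c0 : c = 0.
    by move/eqP: e3; rewrite oppr_eq0 !mulf_eq0 (negPf mq0) (negPf tau0) => /eqP.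
  have ba : b = a by move/eqP: e2; rewrite mulf_eq0 (negPf mq0) subr_eq0 => /eqP.
  have a0 : a = 0.
    move/eqP: e1; rewrite ba c0 !mul0r addr0 -mulrBr !mulf_eq0 (negPf mq0) /= subr_eq0.
    case/orP => [/eqP //|/eqP sij]; exfalso.
    (* If si = sj, then xi and xj are opposite, although both are positive. *)
    have : xi + xj = 0 by rewrite /xi /xj sij !rmorphM /= rmorphN1 rmorph1; ring.
    lra.
  by rewrite ba a0 c0.
- by split; [apply: lt_trans Xi _|apply: lt_trans Xj _|apply: lt_trans Xy _]; lra.
- by split=> //; rewrite -subr_gt0; move: Xz; rewrite ltr_norml => /andP[? ?]; lra.
case/andP: Hi => _ Hi; case/andP: Hj => _ Hj; case/andP: Hy => Hy1 Hy2.
split; [exact: lt_trans Hi _ | exact: lt_trans Hj _ |].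
by case: big Hz {Hbig azlh} => /andP[Hz1 Hz2]; [exact: lt_trans Hz2 _ | exact: lt_trans Hz1].
Qed.

(** * The maps in projective coordinates *)

(** Since n is multiplicative, division by S multiplies all three values of n by n(1/S) and keeps
    their order. Each triangle inequality says that one of 1 - a - b, a, b is at most another. *)
Lemma epsK_projective e r (X : nat -> RR) k l (S := X 0%N + X 1%N + X 2%N) :
  is_cubic_basis e -> (forall m, (m < 3)%N -> inK e (X m) /\ 0 < X m) ->
  rat_free (X 0%N) (X 1%N) (X 2%N) -> (k < 3)%N -> (l < 3)%N -> k != l ->
  wnorm e r (X k) < wnorm e r (X (theta k l)) ->
  wnorm e r (X l) < wnorm e r (X (theta k l)) ->
  X l <= X k -> epsK e r (X 1%N / S) (X 2%N / S) k l.
Proof.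
move=> He HX free k3 l3 kl nk nl Xkl.
have [[K0 X0] [K1 X1] [K2 X2]] := And3 (HX 0%N isT) (HX 1%N isT) (HX 2%N isT).
have S0 : 0 < S by rewrite /S; lra.
have KS : inK e S^-1 by apply: inKV => //; do 2?[apply: inKD => //].
have SN : S != 0 by rewrite gt_eqF.
have SV0 : 0 < S^-1 by rewrite invr_gt0.
have cE m : (m < 3)%N -> coordv (X 1%N / S) (X 2%N / S) m = X m / S.
  case: m => [|[|[|]]] //= _.
  by rewrite -{1}(divff SN) -!mulrBl; congr (_ / _); rewrite /S; ring.
have t3 : (theta k l < 3)%N by rewrite /theta; clear -kl; lia.
have nE m : (m < 3)%N -> wnorm e r (X m / S) = wnorm e r (X m) * wnorm e r S^-1.
  by move=> m3; have [Km m0] := HX m m3; exact: wnormM.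
have nS := wnorm_gt0 _ r _ He KS SV0.
have a0 : 0 < X 1%N / S by rewrite divr_gt0.
have b0 : 0 < X 2%N / S by rewrite divr_gt0.
have c0 : 0 < X 0%N / S by rewrite divr_gt0.
have abc : X 1%N / S + X 2%N / S + X 0%N / S = 1.
  by rewrite -!mulrDl -[X in X / _](_ : S = _) ?divff // /S; ring.
have D : inDeltaK e (X 1%N / S) (X 2%N / S).
  split; [exact: inKM | split; [exact: inKM | split; [|split; [|split]]]] => //.
    (* Multiplying x + y a + z b by S gives these coefficients on X_0, X_1, X_2. *)
    move=> x y z E; have [|e1 e2 e3] := free x (x + y) (x + z).
      rewrite -(mul0r S) -E.
      transitivity (ratr x * S + ratr y * (X 1%N / S * S) + ratr z * (X 2%N / S * S)).
        by rewrite !divfK // !rmorphD /= /S; ring.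
      by ring.
    by move: e2 e3; rewrite e1 !add0r.
  by lra.
split=> //; do 3![split=> //].
have vE m n : (m < 3)%N -> (n < 3)%N -> vK e r (X 1%N / S) (X 2%N / S) m n =
    (wnorm e r (X m) * wnorm e r (X n))^-1 / wnorm e r S^-1 ^+ 2.
  by move=> m3 n3; rewrite vK_wnorm !cE // !nE // -invfM; congr (_^-1); ring.
have n0 m : (m < 3)%N -> 0 < wnorm e r (X m).
  by move=> m3; have [Km m0] := HX m m3; exact: wnorm_gt0.
have [nk0 nl0 nt0] := And3 (n0 k k3) (n0 l l3) (n0 _ t3).
rewrite !vE // !ltr_pM2r ?invr_gt0 ?exprn_gt0 //.
have recip u v w : 0 < u -> 0 < v -> 0 < w -> v < w -> (u * w)^-1 < (u * v)^-1 :> RR.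
  by move=> u0 v0 w0 vw; rewrite ltf_pV2 ?posrE ?mulr_gt0 // ltr_pM2l.
rewrite recip // (mulrC (wnorm e r (X k))) recip //.
do 2![split=> //].
split; first by split; [exact: ltW | exact: ltW | lra].
have XS : X l / S <= X k / S by rewrite ler_pM2r.
clear -k3 l3 kl XS abc; move: k l k3 l3 kl XS abc.
by move=> [|[|[|]]] // [|[|[|]]] //=; lra.
Qed.

(** Each of the six formulas subtracts X_j from X_i and renormalises by the new sum S - X_j. *)
Lemma Tmap_projective (X : nat -> RR) i j (S := X 0%N + X 1%N + X 2%N)
    (X' := fun m => if m == i then X i - X j else X m)
    (S' := X' 0%N + X' 1%N + X' 2%N) :
  S != 0 -> S' != 0 -> (i < 3)%N -> (j < 3)%N -> i != j ->
  Tmap i j (X 1%N / S) (X 2%N / S) = (X' 1%N / S', X' 2%N / S').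
Proof.
move=> S0 S'0 i3 j3 ij.
have SE : S' = S - X j.
  rewrite /S' /S /X'; clear -i3 j3 ij; move: i j i3 j3 ij.
  by move=> [|[|[|]]] // [|[|[|]]] //= _ _ _; ring.
rewrite SE in S'0 *; rewrite /X'; clear SE S' X'.
have quot a b c d : b * S = a -> d * S = c -> c != 0 -> b / d = a / c.
  move=> <- <-; rewrite mulf_eq0 negb_or => /andP[d0 _].
  by rewrite -mulf_div divff // mulr1.
have d1 : (1 - X j / S) * S = S - X j by rewrite mulrBl mul1r divfK.
have k1 : X 1%N / S * S = X 1%N by rewrite divfK.
have k2 : X 2%N / S * S = X 2%N by rewrite divfK.
by move: i j i3 j3 ij S'0 d1 => [|[|[|]]] // [|[|[|]]] //= _ _ _ S'0 d1;
  congr (_, _); apply: quot => //;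
  rewrite ?mulrBl ?mulrDl ?mulrBl ?mulrDl -?mulrA ?[S^-1 * S]mulVf // /S; ring.
Qed.

(** Reduces the theorem to order relations on one triple and on its image under the subtraction. *)
Lemma epsK_Tmap_projective e r (X : nat -> RR) i j k l
    (X' := fun m => if m == i then X i - X j else X m) :
  is_cubic_basis e -> (forall m, (m < 3)%N -> inK e (X m) /\ 0 < X m) ->
  rat_free (X 0%N) (X 1%N) (X 2%N) ->
  (i < 3)%N -> (j < 3)%N -> i != j -> (k < 3)%N -> (l < 3)%N -> k != l ->
  wnorm e r (X i) < wnorm e r (X (theta i j)) ->
  wnorm e r (X j) < wnorm e r (X (theta i j)) -> X j < X i ->
  wnorm e r (X' k) < wnorm e r (X' (theta k l)) ->
  wnorm e r (X' l) < wnorm e r (X' (theta k l)) -> X' l <= X' k ->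
  exists a b, inDeltaK e a b /\ epsK e r a b i j /\
    epsK e r (Tmap i j a b).1 (Tmap i j a b).2 k l.
Proof.
move=> He HX free i3 j3 ij k3 l3 kl ni nj Xij nk nl Xkl.
have HX' m : (m < 3)%N -> inK e (X' m) /\ 0 < X' m.
  move=> m3; rewrite /X'; case: ifP => _; last exact: HX.
  have [[Ki _] [Kj _]] := (HX i i3, HX j j3).
  by rewrite subr_gt0; split=> //; apply: inKD => //; exact: inKN.
have free' : rat_free (X' 0%N) (X' 1%N) (X' 2%N).
  rewrite /X'; clear -free i3 j3 ij; move: i j i3 j3 ij.
  by move=> [|[|[|]]] // [|[|[|]]] //= _ _ _;
    auto 8 using rat_free_swap12, rat_free_swap23, rat_free_sub.
have pos (Y : nat -> RR) : (forall m, (m < 3)%N -> inK e (Y m) /\ 0 < Y m) ->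
    Y 0%N + Y 1%N + Y 2%N != 0.
  by move=> HY; rewrite gt_eqF // !addr_gt0 //; apply HY.
have E := epsK_projective _ _ _ _ _ He HX free i3 j3 ij ni nj (ltW Xij).
have E' := epsK_projective _ _ _ _ _ He HX' free' k3 l3 kl nk nl Xkl.
exists (X 1%N / (X 0%N + X 1%N + X 2%N)), (X 2%N / (X 0%N + X 1%N + X 2%N)).
rewrite (Tmap_projective X i j (pos _ HX) (pos _ HX') i3 j3 ij); split; [exact: (proj1 E) | by split].
Qed.

(** * Admissible index pairs and the choice of target values *)

Lemma thetaC i j : theta i j = theta j i.
Proof. by rewrite /theta subnAC. Qed.

Lemma thetaK i j : (i < 3)%N -> (j < 3)%N -> i != j -> theta j (theta i j) = i.
Proof. by move: i j => [|[|[|]]] // [|[|[|]]]. Qed.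

Lemma theta_neq i j : (i < 3)%N -> (j < 3)%N -> i != j ->
  theta i j != i /\ theta i j != j.
Proof. by move: i j => [|[|[|]]] // [|[|[|]]]. Qed.

(** In the first two cases theta(k,l) = theta(i,j), so y must keep the largest n; in the last two
    theta(k,l) = i, so xi - xj must have it. *)
Lemma allowed_pairs i j k l :
  (i < 3)%N -> (j < 3)%N -> i != j -> (k < 3)%N -> (l < 3)%N -> k != l ->
  (k, l) != (i, theta i j) -> (k, l) != (theta i j, i) ->
  (k = i /\ l = j) \/ (k = j /\ l = i) \/
  (k = j /\ l = theta i j) \/ (k = theta i j /\ l = j).
Proof. by rewrite !xpair_eqE /theta; lia. Qed.

Theorem theorem2p7 (e : 'I_3 -> RR) (p q : nat) (i j k l : nat) :
  is_cubic_basis e ->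
  (0 < p)%N -> (0 < q)%N -> coprime p q -> ~~ (3 %| p)%N ->
  (i < 3)%N -> (j < 3)%N -> i != j ->
  (k < 3)%N -> (l < 3)%N -> k != l ->
  (k, l) != (i, theta i j) -> (k, l) != (theta i j, i) ->
  exists a b : RR,
    let r : RR := p%:R / q%:R in
    inDeltaK e a b /\ epsK e r a b i j /\
    epsK e r (Tmap i j a b).1 (Tmap i j a b).2 k l.
Proof.
move=> He p0 q0 _ _ i3 j3 ij k3 l3 kl n1 n2.
have cases := allowed_pairs _ _ _ _ i3 j3 ij k3 l3 kl n1 n2.
pose r : RR := p%:R / q%:R.
have r0 : 0 < r by rewrite divr_gt0 ?ltr0n.
pose big := (k == i) || (l == i).
(* With vj = 1, the difference vi - vj is 2 or 1/2, as X'_i must end above or below X_j. In the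
   other cases it is 1, and vy is placed below or above vj. *)
pose vi : RR := if big then (if k == i then 3 else 3 / 2) else 2.
pose vy : RR := if k == j then 1 / 2 else 2.
have vij : 1 < vi by rewrite /vi; case: ifP => _; [case: ifP => _|]; lra.
have vy0 : 0 < vy by rewrite /vy; case: ifP => _; lra.
have Hvi : ~~ big -> vi `^ (1 - r) < 4 * (vi - 1) `^ (1 - r) /\
    1 `^ (1 - r) < 4 * (vi - 1) `^ (1 - r).
  move=> /negPf nb; rewrite /vi nb (_ : 2 - 1 = 1); last by ring.
  rewrite powR1 mulr1; split; last by lra.
  (* Since r > 0, 2^(1-r) <= 2 < 4. *)
  by apply: (@le_lt_trans _ _ 2); [apply: ler1_powR|]; lra.
(* A tolerance of 1/8 moves the difference by at most 1/4, which preserves every comparison of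
   target values needed below. *)
have [xi [xj [y [[Ki Kj Ky free] [[ai aj ay] [[i0 j0 y0 xij] [ni nj nz]]]]]]] :=
  exists_wnorm_triple e r vi 1 vy (1 / 8) big He ltr01 vij vy0 ltac:(lra) Hvi.
move: ai aj ay; rewrite !ltr_norml => /andP[ai1 ai2] /andP[aj1 aj2] /andP[ay1 ay2].
pose X m := if m == i then xi else if m == j then xj else y.
have Xi : X i = xi by rewrite /X eqxx.
have Xj : X j = xj by rewrite /X eq_sym (negPf ij) eqxx.
have Xt m : m != i -> m != j -> X m = y by rewrite /X => /negPf-> /negPf->.
have [ti tj] := theta_neq _ _ i3 j3 ij.
have HX m : (m < 3)%N -> inK e (X m) /\ 0 < X m.
  by move=> _; rewrite /X; case: ifP => _ //; case: ifP.
have freeX : rat_free (X 0%N) (X 1%N) (X 2%N).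
  rewrite /X; clear -free i3 j3 ij; move: i j i3 j3 ij.
  by move=> [|[|[|]]] // [|[|[|]]] //= _ _ _;
    auto 8 using rat_free_swap12, rat_free_swap23.
pose X' m := if m == i then X i - X j else X m.
have Xi' : X' i = xi - xj by rewrite /X' eqxx Xi Xj.
have Xj' : X' j = xj by rewrite /X' eq_sym (negPf ij) Xj.
have Xt' : X' (theta i j) = y by rewrite /X' (negPf ti) Xt.
suff [nk nl Xkl] : [/\ wnorm e r (X' k) < wnorm e r (X' (theta k l)),
    wnorm e r (X' l) < wnorm e r (X' (theta k l)) & X' l <= X' k].
  by apply: (epsK_Tmap_projective e r X i j k l) => //; rewrite ?Xi ?Xj ?Xt.
have [[ki lj]|[[kj li]|[[kj lt]|[kt lj]]]] := cases.
- have th : theta k l = theta i j by rewrite ki lj.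
  move: nz ai1 aj2; rewrite th ki lj Xi' Xj' Xt' /vi /big ki eqxx /= => nz ai1 aj2.
  by split=> //; lra.
- have th : theta k l = theta i j by rewrite kj li thetaC.
  move: nz ai2 aj1; rewrite th kj li Xi' Xj' Xt' /vi /big kj li eqxx orbT.
  rewrite eq_sym (negPf ij) => nz ai2 aj1.
  by split=> //; lra.
- have th : theta k l = i by rewrite kj lt thetaK.
  move: nz ay2 aj1; rewrite th kj lt Xi' Xj' Xt' /vy /big kj lt eqxx (negPf ti).
  rewrite eq_sym (negPf ij) /= => nz ay2 aj1.
  by split=> //; [exact: lt_trans nz | lra].
have th : theta k l = i by rewrite kt lj thetaC thetaK.
move: nz ay1 aj2; rewrite th kt lj Xi' Xj' Xt' /vy /big kt lj (negPf ti) (negPf tj).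
rewrite eq_sym (negPf ij) /= => nz ay1 aj2.
by split=> //; [exact: lt_trans nz | lra].
Qed.
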